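(* For all integers $p,q,s\ge 0$ and all $z\in\mathbb{C}$, $$H_{p,q+s}(z,\overline{z})=p!\,q!\sum_{k=0}^{\min(p,q)}\frac{(-1)^{k}}{k!}\,\frac{\overline{z}^{\,q-k}}{(q-k)!}\,\frac{H_{p-k,s}(z,\overline{z})}{(p-k)!}.$$
   Context: For $z=x+iy\in\mathbb{C}$, $\partial_z=\frac12\left(\frac{\partial}{\partial x}-i\frac{\partial}{\partial y}\right)$ and $\partial_{\overline{z}}=\frac12\left(\frac{\partial}{\partial x}+i\frac{\partial}{\partial y}\right)$. The complex Hermite polynomials are, for integers $p,q\ge 0$, $$H_{p,q}(z,\overline{z})=(-1)^{p+q}e^{z\overline{z}}\,\partial_{\overline{z}}^{p}\partial_z^{q}\left(e^{-z\overline{z}}\right).$$ *)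

(* Defs.v *)
From Stdlib Require Import Reals Factorial.
From Coquelicot Require Import Coquelicot.

Local Open Scope C_scope.

Definition Cexp (z : C) : C :=
  RtoC (exp (Re z)) * (cos (Im z), sin (Im z)).

(* Partial derivatives with respect to the real coordinates of [z = x + i y].
   [Derive] is the derivative of a real function of a real variable, hence the
   separate treatment of real and imaginary parts. *)
Definition partial_x (f : C -> C) (z : C) : C :=
  (Derive (fun x : R => Re (f (x, Im z))) (Re z),
   Derive (fun x : R => Im (f (x, Im z))) (Re z)).

Definition partial_y (f : C -> C) (z : C) : C :=
  (Derive (fun y : R => Re (f (Re z, y))) (Im z),
   Derive (fun y : R => Im (f (Re z, y))) (Im z)).

Definition d_z (f : C -> C) (z : C) : C :=
  / 2 * (partial_x f z - Ci * partial_y f z).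

Definition d_zbar (f : C -> C) (z : C) : C :=
  / 2 * (partial_x f z + Ci * partial_y f z).

(* [Hermite p q z] is H_{p,q}(z, conj z). *)
Definition Hermite (p q : nat) (z : C) : C :=
  (- (1)) ^ (p + q) * Cexp (z * Cconj z)
  * Nat.iter p d_zbar (Nat.iter q d_z (fun w => Cexp (- (w * Cconj w)))) z.

(* Main.v *)
Require Import Defs.
From Stdlib Require Import Reals Factorial Lia Lra.
From Coquelicot Require Import Coquelicot.

(** Since [d_z (exp (- z * Cconj z)) = - Cconj z * exp (- z * Cconj z)], commuting
    [Cconj z] past [d_zbar^p] gives the raising relation
    [H_{p,q+1} = Cconj z * H_{p,q} - p * H_{p-1,q}]. Iterating it [q] times from
    [H_{p,s}] is a binomial expansion, in which the [k]-fold lowering operator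
    [H_p |-> p * H_{p-1}] produces the factor [p! / (p-k)!]. *)

Local Open Scope C_scope.

(** * Complex-valued functions of a real variable *)

(** Split into parts to match [partial_x] and [partial_y]. As a relation it also records
    differentiability, which a value of the total function [Derive] does not. *)
Definition is_Cderive (f : R -> C) (x : R) (l : C) : Prop :=
  is_derive (fun t => Re (f t)) x (Re l) /\
  is_derive (fun t => Im (f t)) x (Im l).

Lemma is_Cderive_eq f x l l' : is_Cderive f x l -> l = l' -> is_Cderive f x l'.
Proof. now intros H <-. Qed.

Lemma is_Cderive_ext f g x l :
  (forall t, f t = g t) -> is_Cderive f x l -> is_Cderive g x l.
Proof.
  intros E [H1 H2]; split; eapply is_derive_ext; try eassumption;
    intros t; cbn beta; now rewrite E.
Qed.

Lemma is_Cderive_const (c : C) x : is_Cderive (fun _ => c) x 0.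
Proof. split; apply @is_derive_const. Qed.

Lemma is_Cderive_plus f g x a b :
  is_Cderive f x a -> is_Cderive g x b ->
  is_Cderive (fun t => f t + g t) x (a + b).
Proof.
  intros [F1 F2] [G1 G2]; split; simpl.
  - apply (is_derive_plus _ _ _ _ _ F1 G1).
  - apply (is_derive_plus _ _ _ _ _ F2 G2).
Qed.

Lemma is_derive_Rmult (f g : R -> R) (x a b : R) :
  is_derive f x a -> is_derive g x b ->
  is_derive (fun t => f t * g t)%R x (a * g x + f x * b)%R.
Proof. intros F G; exact (is_derive_mult f g x a b F G Rmult_comm). Qed.

Lemma is_Cderive_mult f g x a b :
  is_Cderive f x a -> is_Cderive g x b ->
  is_Cderive (fun t => f t * g t) x (a * g x + f x * b).
Proof.
  intros [F1 F2] [G1 G2]; split.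
  - evar_last.
    + exact (is_derive_minus _ _ _ _ _ (is_derive_Rmult _ _ _ _ _ F1 G1)
               (is_derive_Rmult _ _ _ _ _ F2 G2)).
    + unfold minus, plus, opp, Re, Im; simpl; ring.
  - evar_last.
    + exact (is_derive_plus _ _ _ _ _ (is_derive_Rmult _ _ _ _ _ F1 G2)
               (is_derive_Rmult _ _ _ _ _ F2 G1)).
    + unfold plus, Re, Im; simpl; ring.
Qed.

Lemma is_Cderive_Cexp f x a :
  is_Cderive f x a -> is_Cderive (fun t => Cexp (f t)) x (Cexp (f x) * a).
Proof.
  intros [F1 F2]; split.
  - apply (is_derive_ext (fun t => exp (Re (f t)) * cos (Im (f t)))%R).
    { intros t; unfold Cexp; simpl; ring. }
    evar_last.
    + exact (is_derive_Rmult _ _ _ _ _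
               (is_derive_comp exp _ _ _ _ (is_derive_exp _) F1)
               (is_derive_comp cos _ _ _ _ (is_derive_cos _) F2)).
    + unfold scal, Cexp, Re, Im; simpl; unfold mult; simpl; ring.
  - apply (is_derive_ext (fun t => exp (Re (f t)) * sin (Im (f t)))%R).
    { intros t; unfold Cexp; simpl; ring. }
    evar_last.
    + exact (is_derive_Rmult _ _ _ _ _
               (is_derive_comp exp _ _ _ _ (is_derive_exp _) F1)
               (is_derive_comp sin _ _ _ _ (is_derive_sin _) F2)).
    + unfold scal, Cexp, Re, Im; simpl; unfold mult; simpl; ring.
Qed.

(** * Calculus of the two Wirtinger derivatives *)

(* [a] and [b] are the values of [d_z f] and [d_zbar f] at [z]. *)
Definition is_wirtinger (f : C -> C) (z a b : C) : Prop :=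
  is_Cderive (fun x => f (x, Im z)) (Re z) (a + b) /\
  is_Cderive (fun y => f (Re z, y)) (Im z) (Ci * (a - b)).

Lemma is_wirtinger_partial f z a b :
  is_wirtinger f z a b ->
  partial_x f z = a + b /\ partial_y f z = Ci * (a - b).
Proof.
  intros [[X1 X2] [Y1 Y2]]; split; apply injective_projections;
    apply is_derive_unique; assumption.
Qed.

Lemma Ci_mul_Ci (x : C) : Ci * (Ci * x) = - x.
Proof. apply injective_projections; simpl; ring. Qed.

Lemma RtoC_neq_0 (r : R) : r <> 0%R -> RtoC r <> 0.
Proof. intros Hr E; exact (Hr (RtoC_inj _ _ E)). Qed.

Lemma is_wirtinger_d_z f z a b : is_wirtinger f z a b -> d_z f z = a.
Proof.
  intros H; destruct (is_wirtinger_partial _ _ _ _ H) as [X Y].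
  unfold d_z; rewrite X, Y, Ci_mul_Ci.
  field; apply RtoC_neq_0; lra.
Qed.

Lemma is_wirtinger_d_zbar f z a b : is_wirtinger f z a b -> d_zbar f z = b.
Proof.
  intros H; destruct (is_wirtinger_partial _ _ _ _ H) as [X Y].
  unfold d_zbar; rewrite X, Y, Ci_mul_Ci.
  field; apply RtoC_neq_0; lra.
Qed.

Lemma is_wirtinger_eq f z a b a' b' :
  is_wirtinger f z a b -> a = a' -> b = b' -> is_wirtinger f z a' b'.
Proof. now intros H <- <-. Qed.

Lemma is_wirtinger_ext f g z a b :
  (forall w, f w = g w) -> is_wirtinger f z a b -> is_wirtinger g z a b.
Proof.
  intros E [H1 H2]; split; eapply is_Cderive_ext; try eassumption;
    intros t; apply E.
Qed.

Lemma is_wirtinger_const (c z : C) : is_wirtinger (fun _ => c) z 0 0.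
Proof.
  split; eapply is_Cderive_eq; try apply is_Cderive_const; ring.
Qed.

Lemma is_wirtinger_id z : is_wirtinger (fun w => w) z 1 0.
Proof.
  split; split; simpl.
  - evar_last; [apply @is_derive_id | unfold one; simpl; ring].
  - evar_last; [apply @is_derive_const | unfold zero; simpl; ring].
  - evar_last; [apply @is_derive_const | unfold zero; simpl; ring].
  - evar_last; [apply @is_derive_id | unfold one; simpl; ring].
Qed.

Lemma is_wirtinger_Cconj z : is_wirtinger Cconj z 0 1.
Proof.
  split; split; simpl.
  - evar_last; [apply @is_derive_id | unfold one; simpl; ring].
  - evar_last; [apply @is_derive_const | unfold zero; simpl; ring].
  - evar_last; [apply @is_derive_const | unfold zero; simpl; ring].
  - evar_last; [apply @is_derive_opp, @is_derive_id | unfold opp, one; simpl; ring].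
Qed.

Lemma is_wirtinger_plus f g z a b a' b' :
  is_wirtinger f z a b -> is_wirtinger g z a' b' ->
  is_wirtinger (fun w => f w + g w) z (a + a') (b + b').
Proof.
  intros [F1 F2] [G1 G2]; split; eapply is_Cderive_eq;
    try (apply is_Cderive_plus; eassumption); ring.
Qed.

Lemma Re_Im_eta (z : C) : (Re z, Im z) = z.
Proof. now destruct z. Qed.

Lemma is_wirtinger_mult f g z a b a' b' :
  is_wirtinger f z a b -> is_wirtinger g z a' b' ->
  is_wirtinger (fun w => f w * g w) z (a * g z + f z * a') (b * g z + f z * b').
Proof.
  intros [F1 F2] [G1 G2]; split; eapply is_Cderive_eq;
    try (apply is_Cderive_mult; eassumption);
    cbn beta; rewrite Re_Im_eta; ring.
Qed.

(** The exponential is holomorphic, so the chain rule has no term in the conjugate of [f]. *)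
Lemma is_wirtinger_Cexp f z a b :
  is_wirtinger f z a b ->
  is_wirtinger (fun w => Cexp (f w)) z (Cexp (f z) * a) (Cexp (f z) * b).
Proof.
  intros [F1 F2]; split; eapply is_Cderive_eq;
    try (apply is_Cderive_Cexp; eassumption);
    cbn beta; rewrite Re_Im_eta; ring.
Qed.

Lemma is_wirtinger_scal (c : C) f z a b :
  is_wirtinger f z a b -> is_wirtinger (fun w => c * f w) z (c * a) (c * b).
Proof.
  intros H; eapply is_wirtinger_eq.
  - exact (is_wirtinger_mult _ _ _ _ _ _ _ (is_wirtinger_const c z) H).
  - cbn beta; ring.
  - cbn beta; ring.
Qed.

Lemma is_wirtinger_pow f z a b n :
  is_wirtinger f z a b ->
  is_wirtinger (fun w => f w ^ n) z
    (INR n * f z ^ (n - 1) * a) (INR n * f z ^ (n - 1) * b).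
Proof.
  intros H; induction n as [|n IH].
  - eapply is_wirtinger_eq; [exact (is_wirtinger_const 1 z) | simpl; ring | simpl; ring].
  - eapply is_wirtinger_eq; [exact (is_wirtinger_mult _ _ _ _ _ _ _ H IH) | |];
      (* At exponent zero [n - 1] truncates to 0, but the factor [INR n] vanishes there. *)
      rewrite S_INR, RtoC_plus; (destruct n as [|n];
      [simpl; ring | replace (S (S n) - 1)%nat with (S n) by lia;
       replace (S n - 1)%nat with n by lia; simpl Cpow; ring]).
Qed.

(** * The Gaussian and the polynomials it generates *)

Definition gauss (w : C) : C := Cexp (- (w * Cconj w)).

Lemma is_wirtinger_gauss z :
  is_wirtinger gauss z (gauss z * - Cconj z) (gauss z * - z).
Proof.
  apply (is_wirtinger_Cexp (fun w => - (w * Cconj w)) z).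
  apply (is_wirtinger_ext (fun w => - (1) * (w * Cconj w))); [intros w; ring |].
  eapply is_wirtinger_eq.
  - apply is_wirtinger_scal, is_wirtinger_mult;
      [apply is_wirtinger_id | apply is_wirtinger_Cconj].
  - simpl; ring.
  - simpl; ring.
Qed.

(** Since [z * Cconj z] is real, this reduces to the real identity for [exp (- r)]. *)
Lemma Cexp_mul_gauss z : Cexp (z * Cconj z) * gauss z = 1.
Proof.
  unfold gauss, Cexp.
  replace (Im (z * Cconj z)) with 0%R by (simpl; ring).
  replace (Im (- (z * Cconj z))) with 0%R by (simpl; ring).
  replace (Re (- (z * Cconj z))) with (- Re (z * Cconj z))%R by reflexivity.
  rewrite exp_Ropp, cos_0, sin_0.
  pose proof (exp_pos (Re (z * Cconj z))).
  apply injective_projections; simpl; field; simpl in *; lra.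
Qed.

(** The raising relation in [q] is taken as the definition, started at $H_{p,0} = z^p$. For [p = 0]
    the truncated [p - 1] is harmless because of the factor [INR p]. *)
Fixpoint hermite_poly (p q : nat) (z : C) : C :=
  match q with
  | O => z ^ p
  | S q' => Cconj z * hermite_poly p q' z - INR p * hermite_poly (p - 1) q' z
  end.

Lemma hermite_poly_0_l q z : hermite_poly 0 q z = Cconj z ^ q.
Proof. induction q as [|q IH]; simpl; [ring | rewrite IH; ring]. Qed.

(** Differentiating the recursion in [q], the factor [Cconj z] contributes one extra copy of
    $H_{p,q}$ to the second derivative; all other terms regroup by the raising relation. *)
Lemma is_wirtinger_hermite_poly p q z :
  is_wirtinger (hermite_poly p q) z
    (INR p * hermite_poly (p - 1) q z) (INR q * hermite_poly p (q - 1) z).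
Proof.
  revert p; induction q as [|q IH]; intros p.
  - eapply is_wirtinger_eq.
    + apply is_wirtinger_pow, is_wirtinger_id.
    + simpl; ring.
    + simpl; ring.
  - apply (is_wirtinger_ext (fun w =>
      Cconj w * hermite_poly p q w + - INR p * hermite_poly (p - 1) q w)).
    { intros w; simpl; ring. }
    eapply is_wirtinger_eq.
    + apply is_wirtinger_plus.
      * apply is_wirtinger_mult; [apply is_wirtinger_Cconj | apply IH].
      * apply is_wirtinger_scal, IH.
    + simpl; ring.
    + rewrite S_INR, RtoC_plus. destruct q as [|q].
      * simpl; ring.
      * replace (S (S q) - 1)%nat with (S q) by lia.
        replace (S q - 1)%nat with q by lia.
        simpl hermite_poly; ring.
Qed.

Lemma hermite_poly_S_r p q z :
  hermite_poly p (S q) z = Cconj z * hermite_poly p q z - INR p * hermite_poly (p - 1) q z.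
Proof. reflexivity. Qed.

(** The mirror recurrence, in [p]: it is what [d_zbar] produces when applied to [hermite_poly p q]
    times [gauss]. *)
Lemma hermite_poly_S_l p q z :
  hermite_poly (S p) q z = z * hermite_poly p q z - INR q * hermite_poly p (q - 1) z.
Proof.
  revert p; induction q as [|q IH]; intros p; [simpl; ring |].
  rewrite !hermite_poly_S_r.
  replace (S p - 1)%nat with p by lia; replace (S q - 1)%nat with q by lia.
  destruct p as [|p].
  - rewrite IH, !hermite_poly_0_l; destruct q as [|q]; [simpl; ring |].
    rewrite !S_INR, !RtoC_plus; simpl; rewrite Nat.sub_0_r; ring.
  - replace (S p - 1)%nat with p by lia.
    rewrite (IH (S p)), (S_INR (S p)), (S_INR q), !RtoC_plus.
    assert (Hl : z * hermite_poly p q z =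
                 hermite_poly (S p) q z + INR q * hermite_poly p (q - 1) z).
    { rewrite (IH p); ring. }
    (* The raising relation from [q - 1] to [q], multiplied by [INR q] so that it also holds for
       [q = 0]. *)
    assert (Hr : INR q * hermite_poly (S p) q z =
                 INR q * (Cconj z * hermite_poly (S p) (q - 1) z
                          - INR (S p) * hermite_poly p (q - 1) z)).
    { destruct q as [|q].
      - change (INR 0) with 0%R; ring.
      - rewrite hermite_poly_S_r.
        replace (S p - 1)%nat with p by lia; replace (S q - 1)%nat with q by lia.
        reflexivity. }
    (* The terms are grouped so that the right side of [Hr] appears verbatim. *)
    transitivity (z * Cconj z * hermite_poly (S p) q z
      - INR q * (Cconj z * hermite_poly (S p) (q - 1) z
                 - INR (S p) * hermite_poly p (q - 1) z)
      - INR q * INR (S p) * hermite_poly p (q - 1) z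
      - (INR (S p) + 1) * hermite_poly (S p) q z); [ring |].
    rewrite <- Hr.
    transitivity (z * Cconj z * hermite_poly (S p) q z
      - INR (S p) * (z * hermite_poly p q z)
      - (INR q + 1) * hermite_poly (S p) q z); [rewrite Hl; ring | ring].
Qed.

(** * Iterated derivatives of the Gaussian *)

(** Each [d_z] brings down a factor [- Cconj w], and [Cconj w] is constant for [d_z]. *)
Lemma iter_d_z_gauss q w : Nat.iter q d_z gauss w = (- Cconj w) ^ q * gauss w.
Proof.
  revert w; induction q as [|q IH]; intros w; [simpl; ring |].
  change (Nat.iter (S q) d_z gauss w) with (d_z (Nat.iter q d_z gauss) w).
  eapply is_wirtinger_d_z, is_wirtinger_ext.
  { intros v; symmetry; apply IH. }
  eapply is_wirtinger_eq.
  - apply is_wirtinger_mult; [| apply is_wirtinger_gauss].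
    apply is_wirtinger_pow.
    apply (is_wirtinger_ext (fun v => - (1) * Cconj v)); [intros v; ring |].
    apply is_wirtinger_scal, is_wirtinger_Cconj.
  - simpl; ring.
  (* The value of the other derivative was left open and is fixed here. *)
  - reflexivity.
Qed.

Lemma Cpow_neg1_mul_self n : (- (1)) ^ n * (- (1)) ^ n = RtoC 1.
Proof.
  induction n as [|n IH]; simpl; [ring |].
  transitivity ((- (1)) ^ n * (- (1)) ^ n); [ring | exact IH].
Qed.

Lemma Cpow_opp (x : C) n : (- x) ^ n = (- (1)) ^ n * x ^ n.
Proof. induction n as [|n IH]; simpl; [ring | rewrite IH; ring]. Qed.

(** By the recurrence in [p], each [d_zbar] raises [p] by one and changes the sign. *)
Lemma iter_d_zbar_d_z_gauss p q w :
  Nat.iter p d_zbar (Nat.iter q d_z gauss) w =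
  (- (1)) ^ (p + q) * (hermite_poly p q w * gauss w).
Proof.
  revert w; induction p as [|p IH]; intros w.
  - cbn [Nat.iter nat_rect]. change (Nat.add 0 q) with q.
    rewrite hermite_poly_0_l. simpl. rewrite iter_d_z_gauss, Cpow_opp; ring.
  - change (d_zbar (Nat.iter p d_zbar (Nat.iter q d_z gauss)) w =
      (- (1)) ^ (S p + q) * (hermite_poly (S p) q w * gauss w)).
    eapply is_wirtinger_d_zbar, is_wirtinger_ext.
    { intros v; symmetry; apply IH. }
    eapply is_wirtinger_eq.
    + apply is_wirtinger_scal, is_wirtinger_mult;
        [apply is_wirtinger_hermite_poly | apply is_wirtinger_gauss].
    + reflexivity.
    + rewrite hermite_poly_S_l; simpl; ring.
Qed.

Lemma Hermite_hermite_poly p q z : Hermite p q z = hermite_poly p q z.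
Proof.
  unfold Hermite.
  change (fun w => Cexp (- (w * Cconj w))) with gauss.
  rewrite iter_d_zbar_d_z_gauss.
  transitivity ((- (1)) ^ (p + q) * (- (1)) ^ (p + q)
                * (Cexp (z * Cconj z) * gauss z) * hermite_poly p q z); [ring |].
  rewrite Cpow_neg1_mul_self, Cexp_mul_gauss; ring.
Qed.

(** * Finite sums and the binomial expansion *)

(* [sum_n] types its equations in an abelian monoid, where [ring] and [field] fail. *)
Ltac C_eq := match goal with |- ?x = ?y => change (@eq C x y) end.

Lemma sum_n_C_Sn (u : nat -> C) n : sum_n u (S n) = sum_n u n + u (S n).
Proof. exact (sum_Sn u n). Qed.

Lemma sum_n_C_S_l (u : nat -> C) n : sum_n u (S n) = u O + sum_n (fun i => u (S i)) n.
Proof.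
  induction n as [|n IH].
  - now rewrite sum_n_C_Sn, !sum_O.
  - rewrite sum_n_C_Sn, IH, (sum_n_C_Sn (fun i => u (S i))).
    symmetry; apply Cplus_assoc.
Qed.

Lemma sum_n_C_mult_l (c : C) (u : nat -> C) n :
  sum_n (fun i => c * u i) n = c * sum_n u n.
Proof. exact (sum_n_mult_l (K := C_Ring) c u n). Qed.

Lemma sum_n_C_plus (u v : nat -> C) n :
  sum_n (fun i => u i + v i) n = sum_n u n + sum_n v n.
Proof. exact (sum_n_plus u v n). Qed.

Lemma C_n_0 n : Binomial.C n 0 = 1%R.
Proof. unfold Binomial.C; rewrite Nat.sub_0_r; simpl; field; apply INR_fact_neq_0. Qed.

(* Binomial expansion of [(x + shift)^n] applied to the sequence [F 0]. *)
Lemma sum_binomial_shift (x : C) (F : nat -> nat -> C) :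
  (forall n k, F (S n) k = x * F n k + F n (S k)) ->
  forall n k,
    F n k = sum_n (fun i => Binomial.C n i * x ^ (n - i) * F O (k + i)%nat) n.
Proof.
  intros HF n; induction n as [|n IH]; intros k.
  - rewrite sum_O, C_n_0, Nat.add_0_r; simpl; ring.
  - rewrite HF, (IH k), (IH (S k)).
    rewrite sum_n_C_S_l, C_n_0, Nat.add_0_r, Nat.sub_0_r.
    destruct n as [|n].
    + rewrite !sum_O, !C_n_0, C_n_n.
      replace (k + 0)%nat with k by lia.
      replace (S k + 0)%nat with (S k) by lia.
      replace (k + 1)%nat with (S k) by lia.
      simpl; ring.
    (* The first sum on the left loses its bottom term, the other two sums their top term. All three
       then run over [i <= n], where Pascal's rule applies termwise. *)
    + rewrite (sum_n_C_S_l _ n), !sum_n_C_Sn, C_n_0, !C_n_n, Nat.add_0_r,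
        !Nat.sub_diag, !Nat.sub_0_r.
      pose (u i := Binomial.C (S n) (S i) * x ^ (S n - S i) * F O (k + S i)%nat).
      pose (v i := Binomial.C (S n) i * x ^ (S n - i) * F O (S k + i)%nat).
      change (sum_n (fun i => Binomial.C (S n) (S i) * x ^ (S n - S i)
                              * F O (k + S i)%nat) n) with (sum_n u n).
      change (sum_n (fun i => Binomial.C (S n) i * x ^ (S n - i)
                              * F O (S k + i)%nat) n) with (sum_n v n).
      rewrite (sum_n_ext_loc
        (fun i => Binomial.C (S (S n)) (S i) * x ^ (S (S n) - S i) * F O (k + S i)%nat)
        (fun i => x * u i + v i)).
      2:{ intros i Hi; unfold u, v; rewrite <- pascal, RtoC_plus by lia.
          replace (S (S n) - S i)%nat with (S (n - i)) by lia.
          replace (S n - i)%nat with (S (n - i)) by lia.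
          replace (S n - S i)%nat with (n - i)%nat by lia.
          replace (S k + i)%nat with (k + S i)%nat by lia.
          simpl Cpow; C_eq; ring. }
      rewrite sum_n_C_plus, sum_n_C_mult_l.
      generalize (sum_n u n) (sum_n v n); clear u v; intros u v.
      replace (S k + S n)%nat with (k + S (S n))%nat by lia.
      simpl Cpow; C_eq; ring.
Qed.

(** * Falling factorials *)

(** The coefficient $p(p-1)\cdots(p-k+1)$ produced by [k] lowerings; truncation leaves a zero factor
    when [k] exceeds [p]. *)
Fixpoint falling (p k : nat) : R :=
  match k with
  | O => 1
  | S k' => INR p * falling (p - 1) k'
  end%R.

(** Splits off the last factor, the one that a further lowering of [hermite_poly (p - k)]
    contributes. *)
Lemma falling_S_r p k : falling p (S k) = (falling p k * INR (p - k))%R.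
Proof.
  revert p; induction k as [|k IH]; intros p.
  - simpl; rewrite Nat.sub_0_r; ring.
  - change (falling p (S (S k))) with (INR p * falling (p - 1) (S k))%R.
    rewrite IH; simpl falling.
    replace (p - 1 - k)%nat with (p - S k)%nat by lia; ring.
Qed.

Lemma falling_fact p k : (k <= p)%nat -> (falling p k * INR (fact (p - k)))%R = INR (fact p).
Proof.
  induction k as [|k IH]; intros Hk.
  - simpl; rewrite Nat.sub_0_r; ring.
  - rewrite <- IH by lia. rewrite falling_S_r.
    replace (p - k)%nat with (S (p - S k)) by lia.
    rewrite fact_simpl, mult_INR; ring.
Qed.

Lemma falling_gt p k : (p < k)%nat -> falling p k = 0%R.
Proof.
  intros H; induction H as [|k H IH]; rewrite falling_S_r.
  - rewrite Nat.sub_diag; simpl; ring.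
  - rewrite IH; ring.
Qed.

(** * The addition formula *)

Lemma hermite_poly_add_r p q s z :
  hermite_poly p (q + s) z =
  sum_n (fun k => Binomial.C q k * Cconj z ^ (q - k)
                  * ((- (1)) ^ k * falling p k * hermite_poly (p - k) s z)) q.
Proof.
  (* [F n k] is the [k]-fold signed lowering of $H_{p,n+s}$; the raising relation is then the shift
     recurrence with [x = Cconj z]. *)
  pose (F n k := (- (1)) ^ k * falling p k * hermite_poly (p - k) (n + s) z).
  transitivity (F q O).
  { unfold F; simpl; rewrite Nat.sub_0_r; ring. }
  apply (sum_binomial_shift (Cconj z) F).
  intros n k; unfold F.
  rewrite falling_S_r, RtoC_mult.
  replace (p - S k)%nat with (p - k - 1)%nat by lia.
  simpl; ring.
Qed.

Lemma sum_n_C_trailing_0 (u : nat -> C) m n :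
  (m <= n)%nat -> (forall k, (m < k <= n)%nat -> u k = 0) -> sum_n u n = sum_n u m.
Proof.
  intros H; induction H as [|n H IH]; intros Hu; [reflexivity |].
  rewrite sum_n_C_Sn, Hu, IH by (intros; try apply Hu; lia); apply Cplus_0_r.
Qed.

Theorem mainTheorem7 (p q s : nat) (z : C) :
  (Hermite p (q + s) z =
   INR (fact p) * INR (fact q) *
   sum_n (fun k : nat =>
            (- (1)) ^ k / INR (fact k)
            * (Cconj z ^ (q - k) / INR (fact (q - k)))
            * (Hermite (p - k) s z / INR (fact (p - k))))
         (Nat.min p q))%C.
Proof.
  rewrite Hermite_hermite_poly, hermite_poly_add_r.
  (* The binomial sum runs up to [q]; its terms with [k > p] vanish with [falling p k]. *)
  rewrite (sum_n_C_trailing_0 _ (Nat.min p q)); [| lia |].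
  2:{ intros k Hk; rewrite falling_gt by lia; ring. }
  rewrite <- sum_n_C_mult_l.
  apply sum_n_ext_loc; intros k Hk.
  (* Writing $p!$ as [falling p k] times $(p-k)!$ cancels the denominator $(p-k)!$. *)
  rewrite Hermite_hermite_poly, <- (falling_fact p k) by lia.
  assert (fact_neq : forall n, RtoC (INR (fact n)) <> 0).
  { intros n; apply RtoC_neq_0, INR_fact_neq_0. }
  unfold Binomial.C.
  rewrite RtoC_div, !RtoC_mult
    by (apply Rmult_integral_contrapositive_currified; apply INR_fact_neq_0).
  C_eq; field; auto.
Qed.
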